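(* Let $m\ge 1$, $1\le p<\infty$, let $X$ be any one of the four sets $\widetilde{S}^{m}$, $E^{m}$, $S_0^{m}$, $S^{m}$, and let $U\subset X$. Then $U$ is totally bounded in $(X,d_p)$ if and only if (i) $U$ is uniformly $p$-mean bounded; and (ii) $U$ is $p$-mean equi-left-continuous.
   Context: $H$ is the Hausdorff metric on nonempty closed subsets of $\mathbb{R}^m$ (Euclidean distance): $H(A,B)=\max\{\sup_{a\in A}\inf_{b\in B}d(a,b),\ \sup_{b\in B}\inf_{a\in A}d(a,b)\}$. A fuzzy set on $\mathbb{R}^m$ is a function $u:\mathbb{R}^m\to[0,1]$; its cuts are $[u]_\alpha=\{x: u(x)\ge\alpha\}$ for $\alpha\in(0,1]$ and $[u]_0=\overline{\{x: u(x)>0\}}$. $F_B(\mathbb{R}^m)$ is the set of fuzzy sets $u$ on $\mathbb{R}^m$ that are normal ($u(x_0)=1$ for some $x_0$), upper semi-continuous, and have $[u]_0$ bounded. The metric is $d_p(u,v)=\left(\int_0^1 H([u]_\alpha,[v]_\alpha)^p\,d\alpha\right)^{1/p}$. Subsets of $F_B(\mathbb{R}^m)$: - $E^{m}$: those $u$ that are fuzzy convex, i.e. $u(\lambda x+(1-\lambda)y)\ge\min\{u(x),u(y)\}$ for all $x,y\in\mathbb{R}^m$, $\lambda\in[0,1]$; - $S_0^{m}$: those $u$ with $u(\lambda y)\ge u(y)$ for all $y\in\mathbb{R}^m$, $\lambda\in[0,1]$; - $S^{m}$: those $u$ for which there is $x\in\mathbb{R}^m$ with $u(\lambda y+(1-\lambda)x)\ge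 u(y)$ for all $y\in\mathbb{R}^m$, $\lambda\in[0,1]$; - $\widetilde{S}^{m}$: those $u$ such that for every $\alpha\in(0,1]$ there is $x_\alpha\in[u]_\alpha$ such that for all $y\in[u]_\alpha$ the segment $\overline{x_\alpha y}$ is contained in $[u]_\alpha$. A set $U$ of such fuzzy sets is uniformly $p$-mean bounded if there is $M>0$ with $d_p(u,\widehat{0})\le M$ for all $u\in U$, where $\widehat 0$ is the characteristic function of $\{0\}$ ($0$ the origin). $U$ is $p$-mean equi-left-continuous if for every $\varepsilon>0$ there is $\delta>0$ such that for all $0\le h<\delta$ and all $u\in U$, $\left(\int_h^1 H([u]_\alpha,[u]_{\alpha-h})^p\,d\alpha\right)^{1/p}<\varepsilon$. *)

(* Defs.v *)
From HB Require Import structures.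
From mathcomp Require Import all_boot all_order all_algebra.
From mathcomp Require Import all_classical all_reals all_analysis.
Set Implicit Arguments.
Unset Strict Implicit.
Unset Printing Implicit Defensive.
Import Order.TTheory GRing.Theory Num.Theory.
Import numFieldNormedType.Exports.
Local Open Scope classical_set_scope.
Local Open Scope ring_scope.

(* R^m is 'rV[R]_m.  The library norm on 'rV[R]_m is the sup norm; it is used
   below only for the topology and for boundedness, where it agrees with the
   Euclidean one.  Distances are Euclidean. *)
Definition edist (R : realType) (m : nat) (x y : 'rV[R]_m) : R :=
  Num.sqrt (\sum_(i < m) (x ord0 i - y ord0 i) ^+ 2).

(* Valued in \bar R, hence meaningful without any boundedness assumption. *)
Definition hausdorff_dist (R : realType) (m : nat) (A B : set 'rV[R]_m) :
    \bar R :=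
  Order.max
    (ereal_sup [set ereal_inf [set (edist a b)%:E | b in B] | a in A])
    (ereal_sup [set ereal_inf [set (edist a b)%:E | a in A] | b in B]).

Definition fuzzy_set (R : realType) (m : nat) (u : 'rV[R]_m -> R) : Prop :=
  forall x, 0 <= u x <= 1.

(* Only used for alpha in [0, 1]. *)
Definition cut (R : realType) (m : nat) (u : 'rV[R]_m -> R) (alpha : R) :
    set 'rV[R]_m :=
  if alpha == 0 then closure [set x | 0 < u x] else [set x | alpha <= u x].

Definition upper_semicontinuous (R : realType) (T : topologicalType)
    (u : T -> R) : Prop :=
  forall (x : T) (a : R), u x < a -> \forall y \near x, u y < a.

Definition FB (R : realType) (m : nat) : set ('rV[R]_m -> R) :=
  [set u | [/\ fuzzy_set u,
               exists x0, u x0 = 1,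
               upper_semicontinuous u &
               bounded_set (cut u 0)]].

Definition fuzzy_E (R : realType) (m : nat) : set ('rV[R]_m -> R) :=
  [set u | FB u /\ forall (x y : 'rV[R]_m) (lambda : R), 0 <= lambda <= 1 ->
     Num.min (u x) (u y) <= u (lambda *: x + (1 - lambda) *: y)].

Definition fuzzy_S0 (R : realType) (m : nat) : set ('rV[R]_m -> R) :=
  [set u | FB u /\ forall (y : 'rV[R]_m) (lambda : R), 0 <= lambda <= 1 ->
     u y <= u (lambda *: y)].

Definition fuzzy_S (R : realType) (m : nat) : set ('rV[R]_m -> R) :=
  [set u | FB u /\ exists x : 'rV[R]_m,
     forall (y : 'rV[R]_m) (lambda : R), 0 <= lambda <= 1 ->
     u y <= u (lambda *: y + (1 - lambda) *: x)].

Definition line_segment (R : realType) (m : nat) (x y : 'rV[R]_m) :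
    set 'rV[R]_m :=
  [set lambda *: y + (1 - lambda) *: x | lambda in `[0%R, 1%R]%classic].

Definition fuzzy_Stilde (R : realType) (m : nat) : set ('rV[R]_m -> R) :=
  [set u | FB u /\ forall alpha : R, 0 < alpha <= 1 ->
     exists2 x, cut u alpha x &
       forall y, cut u alpha y -> line_segment x y `<=` cut u alpha].

Definition dp (R : realType) (m : nat) (p : R) (u v : 'rV[R]_m -> R) :
    \bar R :=
  ((\int[lebesgue_measure]_(alpha in `[0%R, 1%R])
      (hausdorff_dist (cut u alpha) (cut v alpha) `^ p)) `^ p^-1)%E.

Definition hat0 (R : realType) (m : nat) : 'rV[R]_m -> R :=
  \1_[set (0 : 'rV[R]_m)].

Definition p_mean_bounded (R : realType) (m : nat) (p : R)
    (U : set ('rV[R]_m -> R)) : Prop :=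
  exists2 M : R, 0 < M & forall u, U u -> (dp p u (@hat0 R m) <= M%:E)%E.

(* If h > 1, the domain of integration is empty. *)
Definition p_mean_equi_left_continuous (R : realType) (m : nat) (p : R)
    (U : set ('rV[R]_m -> R)) : Prop :=
  forall eps : R, 0 < eps ->
  exists2 delta : R, 0 < delta &
    forall h : R, 0 <= h < delta -> forall u, U u ->
    ((\int[lebesgue_measure]_(alpha in `[h, 1%R])
        (hausdorff_dist (cut u alpha) (cut u (alpha - h)%R) `^ p)) `^ p^-1
     < eps%:E)%E.

(* The library has no total boundedness; this is the existence, for each eps,
   of a finite eps-net of U with centers in the ambient space X. *)
Definition totally_bounded_in (T : Type) (R : realType) (d : T -> T -> \bar R)
    (X U : set T) : Prop :=
  forall eps : R, 0 < eps ->
  exists S : set T, [/\ finite_set S, S `<=` X &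
    forall u, U u -> exists2 v, S v & (d u v < eps%:E)%E].

(* Main.v *)
(* Only the inclusion of X in F_B matters.  A single fuzzy set is left continuous
   in p-mean by dominated convergence, because its cuts are compact and decreasing;
   both properties then pass from a finite net to U.  Conversely, equi-left-continuity
   lets one replace the cuts of u by the cuts at the finitely many levels k h, which
   lie in a common ball except near level 0, where the integrals are uniformly
   small.  Recording which cells of a fine partition of that ball are met by which
   cut sorts U into finitely many classes, and one member of U per class gives
   a finite net. *)
Require Import Defs.
From HB Require Import structures.
From mathcomp Require Import all_boot all_order all_algebra.
From mathcomp Require Import all_classical all_reals all_analysis.
From mathcomp Require Import measurable_realfun.
From mathcomp Require Import ring lra.
Set Implicit Arguments.
Unset Strict Implicit.
Unset Printing Implicit Defensive.
Import Order.TTheory GRing.Theory Num.Theory.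
Import numFieldNormedType.Exports.
Import Defs.
Local Open Scope classical_set_scope.
Local Open Scope ring_scope.

(** Estimates are made on integrals of p-th powers, never on [dp] itself: the root is removed once,
    and the triangle inequality is applied under the integral at the price of a factor 3^p. The
    divisors 4 K, 2 K and 6 K in later constants only absorb that factor and the number of terms.
    Two obstacles shape the argument. Monotone comparison of integrals requires the distance between
    two moving cuts to be measurable in the level; cuts vary continuously only from the left, and
    this one-sided continuity is what makes the superlevel sets measurable. Moreover, rounding a
    level a down to a multiple k h shifts it by an amount depending on a, whereas (ii) controls a
    shift that is the same for all levels. Monotonicity resolves this: the cut at k h lies between
    those at a and a - h, so the rounding error is at most that of the full shift h. Level 0 carries
    a closure and no bound uniform in U, so integrals are taken over half-open intervals, which
    leave it out. *)

Section edist.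
Context {R : realType} {m : nat}.
Implicit Types x y z : 'rV[R]_m.

Lemma edist_ge0 x y : 0 <= edist x y.
Proof. exact: sqrtr_ge0. Qed.

Lemma edistC x y : edist x y = edist y x.
Proof. by congr Num.sqrt; apply: eq_bigr => i _; rewrite -opprB sqrrN. Qed.

Lemma edistxx x : edist x x = 0.
Proof.
by rewrite /edist big1 ?sqrtr0// => i _; rewrite subrr expr0n.
Qed.

(** Cauchy-Schwarz. With [A] and [B] the two norms, the sum of the squares (B a_i - A b_i)^2 equals
    2 A B (A B - sum of a_i b_i). A zero norm forces a zero vector and is set aside, so that A B can
    be cancelled. *)
Lemma sum_mul_le_sqrt (a b : 'I_m -> R) :
  \sum_i a i * b i <= Num.sqrt (\sum_i a i ^+ 2) * Num.sqrt (\sum_i b i ^+ 2).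
Proof.
have sq0 (c : 'I_m -> R) : 0 <= \sum_i c i ^+ 2.
  by apply: sumr_ge0 => i _; exact: sqr_ge0.
have null (c : 'I_m -> R) : \sum_i c i ^+ 2 = 0 -> forall i, c i = 0.
  move=> /eqP; rewrite psumr_eq0 => [/allP c0 i|i _]; last exact: sqr_ge0.
  by apply/eqP; rewrite -sqrf_eq0; apply: c0; rewrite mem_index_enum.
have [/eqP a0|a0] := boolP (\sum_i a i ^+ 2 == 0).
  rewrite a0 sqrtr0 mul0r big1// => i _; by rewrite (null _ a0) mul0r.
have [/eqP b0|b0] := boolP (\sum_i b i ^+ 2 == 0).
  rewrite b0 sqrtr0 mulr0 big1// => i _; by rewrite (null _ b0) mulr0.
set A := Num.sqrt _; set B := Num.sqrt _.
have A2 : \sum_i a i ^+ 2 = A ^+ 2 by rewrite sqr_sqrtr.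
have B2 : \sum_i b i ^+ 2 = B ^+ 2 by rewrite sqr_sqrtr.
have AB : 0 < A * B by rewrite mulr_gt0// sqrtr_gt0 lt_neqAle eq_sym ?a0 ?b0 /=.
rewrite -(ler_pM2l AB) -subr_ge0 -(pmulr_rge0 _ (ltr0n R 2)).
suff -> : 2 * (A * B * (A * B) - A * B * \sum_i a i * b i) =
          \sum_i (B * a i - A * b i) ^+ 2 by [].
under [RHS]eq_bigr => i _.
  rewrite (_ : _ ^+ 2 = B ^+ 2 * a i ^+ 2 + A ^+ 2 * b i ^+ 2
    - 2 * (A * B) * (a i * b i)); last by ring.
  over.
by rewrite sumrB big_split/= -!mulr_sumr A2 B2; ring.
Qed.

Lemma edist_triangle y x z : edist x z <= edist x y + edist y z.
Proof.
have sq0 (c : 'I_m -> R) : 0 <= \sum_i c i ^+ 2.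
  by apply: sumr_ge0 => i _; exact: sqr_ge0.
rewrite -(@ler_pXn2r _ 2)// ?nnegrE ?addr_ge0 ?edist_ge0//.
rewrite sqrrD !sqr_sqrtr ?sq0//.
under eq_bigr => i _.
  rewrite (_ : _ ^+ 2 = (x ord0 i - y ord0 i) ^+ 2 +
    (x ord0 i - y ord0 i) * (y ord0 i - z ord0 i) *+ 2
    + (y ord0 i - z ord0 i) ^+ 2); last by ring.
  over.
rewrite !big_split/= lerD2r lerD2l -mulr2n lerMn2r/=.
exact: sum_mul_le_sqrt.
Qed.

Lemma coord_le_edist x y i : `|x ord0 i - y ord0 i| <= edist x y.
Proof.
rewrite -sqrtr_sqr ler_sqrt; last by apply: sumr_ge0 => j _; exact: sqr_ge0.
by rewrite (bigD1 i)//= lerDl; apply: sumr_ge0 => j _; exact: sqr_ge0.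
Qed.

(** The crude factor m, instead of its square root, comes from m <= m^2; [finite_cell_map]
    compensates by taking smaller cells. *)
Lemma edist_le_coord x y (s : R) : 0 <= s ->
  (forall i, `|x ord0 i - y ord0 i| <= s) -> edist x y <= m%:R * s.
Proof.
move=> s0 xys; have ms0 : 0 <= m%:R * s by rewrite mulr_ge0.
rewrite -(ger0_norm ms0) -sqrtr_sqr ler_sqrt ?sqr_ge0//.
apply: (@le_trans _ _ (\sum_(i < m) s ^+ 2)).
  by apply: ler_sum => i _; rewrite -real_normK ?num_real// lerXn2r ?nnegrE.
rewrite sumr_const card_ord -[leLHS]mulr_natl exprMn ler_wpM2r ?sqr_ge0//.
by rewrite -natrX ler_nat; case: {+}m => // k; rewrite -[leqLHS]expn1 leq_pexp2l.
Qed.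

Lemma edist_continuous x : continuous (edist x).
Proof.
have cb i : continuous (fun z : 'rV[R]_m => x ord0 i - z ord0 i).
  move=> z; apply: continuousB; first exact: cst_continuous.
  exact: coord_continuous.
move=> y; apply: (@continuous_comp _ _ _
  (fun z : 'rV[R]_m => \sum_(i < m) (x ord0 i - z ord0 i) ^+ 2) Num.sqrt);
  last exact: sqrt_continuous.
apply: (@continuous_big R _ +%R 0 xpredT add_continuous) => i _ {}y.
exact: (continuous_comp (cb i y) (@exprn_continuous R 2 _)).
Qed.

Lemma closed_edist_le x (r : R) : closed [set y | edist x y <= r].
Proof.
apply: (@preimage_closed _ _ (edist x) [set t | t <= r]) (@closed_le _ r).
by move=> y _; exact: edist_continuous.
Qed.

Lemma closed_edist_ge x (r : R) : closed [set y | r <= edist x y].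
Proof.
apply: (@preimage_closed _ _ (edist x) [set t | r <= t]) (@closed_ge _ r).
by move=> y _; exact: edist_continuous.
Qed.

End edist.

(** * Hausdorff distance with values in the extended reals *)

Section hausdorff.
Context {R : realType} {m : nat}.
Implicit Types A B C : set 'rV[R]_m.
Local Open Scope ereal_scope.

(** Reduces inequalities between distances to real radii, where [hausdorff_dist_le] and
    [hausdorff_dist_lt] apply; infinite values are dealt with here once. *)
Lemma le_of_lt_fin (x y : \bar R) :
  (forall r : R, y < r%:E -> x <= r%:E) -> x <= y.
Proof.
case: y => [y xy||xy].
- apply/lee_addgt0Pr => e e0; rewrite -EFinD; apply: xy.
  by rewrite lte_fin ltrDl.
- by rewrite leey.
- case: x xy => [x xy|xy|//].
    by have := xy (x - 1)%R (ltNyr _); rewrite lee_fin => ?; exfalso; lra.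
  by have := xy 0%R (ltNyr _).
Qed.

Lemma hausdorff_distC A B : hausdorff_dist A B = hausdorff_dist B A.
Proof.
rewrite /hausdorff_dist maxC; congr (Order.max _ _).
- by congr ereal_sup; apply: eq_imagel => a _; congr ereal_inf;
    apply: eq_imagel => b _; rewrite edistC.
- by congr ereal_sup; apply: eq_imagel => a _; congr ereal_inf;
    apply: eq_imagel => b _; rewrite edistC.
Qed.

Lemma hausdorff_dist_le A B (r : R) :
  (forall a, A a -> exists2 b, B b & (edist a b <= r)%R) ->
  (forall b, B b -> exists2 a, A a & (edist a b <= r)%R) ->
  hausdorff_dist A B <= r%:E.
Proof.
move=> AB BA; rewrite /hausdorff_dist ge_max; apply/andP; split.
- apply: ge_ereal_sup => _ [a Aa <-]; have [b Bb ab] := AB _ Aa.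
  by apply: le_trans (_ : (edist a b)%:E <= _); rewrite ?lee_fin//;
    apply: ereal_inf_lbound; exists b.
- apply: ge_ereal_sup => _ [b Bb <-]; have [a Aa ab] := BA _ Bb.
  by apply: le_trans (_ : (edist a b)%:E <= _); rewrite ?lee_fin//;
    apply: ereal_inf_lbound; exists a.
Qed.

(** The strict inequality is what yields a witness, since the infimum need not be attained. The
    other half follows by [hausdorff_distC]. *)
Lemma hausdorff_dist_lt A B (r : R) : hausdorff_dist A B < r%:E ->
  forall a, A a -> exists2 b, B b & (edist a b < r)%R.
Proof.
rewrite /hausdorff_dist gt_max => /andP[AB _] a Aa.
have /ereal_inf_lt[_ [b Bb <-]] :
    ereal_inf [set (edist a b)%:E | b in B] < r%:E.
  by apply: le_lt_trans AB; apply: ereal_sup_ubound; exists a.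
by rewrite lte_fin => ab; exists b.
Qed.

Lemma hausdorff_dist_ge0 A B : A !=set0 -> 0 <= hausdorff_dist A B.
Proof.
move=> [a Aa]; rewrite /hausdorff_dist le_max; apply/orP; left.
apply: (@le_trans _ _ (ereal_inf [set (edist a b)%:E | b in B])).
  by apply: le_ereal_inf_tmp => _ [b _ <-]; rewrite lee_fin edist_ge0.
by apply: ereal_sup_ubound; exists a.
Qed.

Lemma hausdorff_dist_triangle B A C : A !=set0 -> B !=set0 ->
  hausdorff_dist A C <= hausdorff_dist A B + hausdorff_dist B C.
Proof.
move=> A0 B0; apply: le_of_lt_fin => r.
have := hausdorff_dist_ge0 B A0; have := hausdorff_dist_ge0 C B0.
case EAB: (hausdorff_dist A B) => [s||]//; case EBC: (hausdorff_dist B C) => [t||]//.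
rewrite !lee_fin -EFinD lte_fin => t0 s0 str.
(* Each of the two distances receives half of the slack: both bounds become strict and still add up
   to [r]. *)
pose e := ((r - (s + t)) / 2)%R; have e0 : (0 < e)%R by rewrite /e; lra.
have AB : hausdorff_dist A B < (s + e)%:E by rewrite EAB lte_fin; lra.
have BC : hausdorff_dist B C < (t + e)%:E by rewrite EBC lte_fin; lra.
have rE : r = ((s + e) + (t + e))%R by rewrite /e; field.
apply: hausdorff_dist_le => [a Aa|c Cc].
- have [b Bb ab] := hausdorff_dist_lt AB Aa.
  have [c Cc bc] := hausdorff_dist_lt BC Bb.
  exists c => //; apply: le_trans (edist_triangle b _ _) _.
  by rewrite rE lerD// ltW.
- move: AB BC; rewrite hausdorff_distC => BA; rewrite hausdorff_distC => CB.
  have [b Bb cb] := hausdorff_dist_lt CB Cc.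
  have [a Aa ab] := hausdorff_dist_lt BA Bb.
  exists a => //; apply: le_trans (edist_triangle b _ _) _.
  by rewrite rE lerD// edistC ltW.
Qed.

(** Points of [A] are in [B], and points of [B] are points of [C], hence close to [A]. This bounds
    the cost of an intermediate level by that of a full shift. *)
Lemma hausdorff_dist_nestedl A B C : A `<=` B -> B `<=` C ->
  hausdorff_dist A B <= hausdorff_dist A C.
Proof.
move=> AB BC; apply: le_of_lt_fin => r; rewrite hausdorff_distC => CA.
have [r0|r0] := leP 0%R r; last first.
  apply: hausdorff_dist_le => [a /AB/BC/(hausdorff_dist_lt CA)[b _]|b /BC/(hausdorff_dist_lt CA)[a _]];
    by move=> /ltW/(le_trans (edist_ge0 _ _)); rewrite leNgt r0.
apply: hausdorff_dist_le => [a Aa|b /BC/(hausdorff_dist_lt CA)[a Aa ba]].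
  by exists a; [exact: AB|rewrite edistxx].
by exists a => //; rewrite edistC ltW.
Qed.

(** For a nonempty set, the distance to {0} is the largest norm of its points, which grows with the
    set. *)
Lemma hausdorff_dist_set0_sub A B : A !=set0 -> A `<=` B ->
  hausdorff_dist A [set 0%R] <= hausdorff_dist B [set 0%R].
Proof.
move=> [a Aa] AB; apply: le_of_lt_fin => r B0.
apply: hausdorff_dist_le => [x /AB /(hausdorff_dist_lt B0)[b -> /ltW]|_ ->].
  by exists 0%R.
by have [b -> /ltW ab] := hausdorff_dist_lt B0 (AB _ Aa); exists a.
Qed.

End hausdorff.

(** * Left continuity of cuts, and measurability of the distance between moving cuts *)

Section cuts.
Context {R : realType} {m : nat}.
Implicit Types (u v : 'rV[R]_m -> R) (a b h : R).

Lemma cut_gt0 u a : 0 < a -> cut u a = [set x | a <= u x].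
Proof. by move=> a0; rewrite /cut gt_eqF. Qed.

Lemma cut_sub u a b : 0 <= a <= b -> cut u b `<=` cut u a.
Proof.
move=> /andP[+ ab]; rewrite le_eqVlt => /predU1P[a0|a0].
  rewrite -{}a0 in ab *; rewrite /cut eqxx; case: eqVneq => [_ //|b0] x /= bx; apply: subset_closure => /=.
  by apply: lt_le_trans bx; rewrite lt_neqAle eq_sym b0 ab.
by rewrite !cut_gt0 ?(lt_le_trans a0 ab)// => x /=; exact: le_trans.
Qed.

Lemma cut_neq0 u a : FB u -> 0 <= a <= 1 -> cut u a !=set0.
Proof.
move=> [_ [x ux] _ _] /cut_sub-/(_ u) sub; exists x; apply: sub.
by rewrite cut_gt0//= ux.
Qed.

Lemma FB_bounded u : FB u ->
  exists2 C : R, 0 <= C & forall a x, 0 <= a -> cut u a x -> edist x 0 <= C.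
Proof.
move=> [_ _ _ [C0 [_ /(_ (C0 + 1)) bC]]]; set C := C0 + 1 in bC.
(* The factor [m] passes from the sup norm of [bounded_set] to the Euclidean distance. *)
exists (m%:R * Num.max 0 C).
  by rewrite mulr_ge0// le_max lexx.
move=> a x a0 uax; apply: edist_le_coord => [|i]; first by rewrite le_max lexx.
rewrite mxE subr0 le_max; apply/orP; right.
have : `|x| <= C.
  by apply: bC; rewrite /C ?ltrDl//; apply: (cut_sub _ uax); rewrite lexx.
apply: le_trans.
rewrite [leRHS]/Num.norm/= mx_normrE.
by apply: (le_trans _ (le_bigmax _ _ (ord0, i))).
Qed.

(* By upper semicontinuity, the sets {u < s} with s < b form an open cover of the
   compact set F `&` cut u 0. *)
Lemma cut_disjoint_left u (F : set 'rV[R]_m) b : FB u -> closed F -> 0 < b ->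
  F `&` cut u b = set0 -> exists2 s, 0 < s < b & F `&` cut u s = set0.
Proof.
move=> [fu _ uscu bu] clF b0 Fb.
have cK : compact (F `&` cut u 0).
  apply: bounded_closed_compact.
    have [M [Mr bM]] := bu; exists M; split=> // N MN x [_ ux].
    exact: (bM N MN).
  by apply: closedI => //; rewrite /cut eqxx; exact: closed_closure.
have/compact_near_coveringP/(_ R (b^'-) (fun s x => u x < s)) := cK.
move=> covering.
have near_b : \forall s \near b^'-, F `&` cut u 0 `<=` (fun x => u x < s).
  apply: covering => x [Fx _]; have uxb : u x < b.
    rewrite ltNge; apply/negP => bux.
    by have : set0 x by rewrite -Fb; split => //; rewrite cut_gt0.
  (* The midpoint separates the two variables: [u] stays below it near [x], and [s] stays above it
     near [b]. *)
  have /uscu ux : u x < (u x + b) / 2 by lra.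
  exists ([set y | u y < (u x + b) / 2], [set s | (u x + b) / 2 < s]) => /=.
    by split=> //; apply: nbhs_left_gt; lra.
  by move=> [y s] /= [uy ys]; exact: lt_trans ys.
have : \forall s \near b^'-, [/\ 0 < s, s < b &
    F `&` cut u 0 `<=` (fun x => u x < s)].
  near=> s; split; near: s => //; first exact: nbhs_left_gt.
  exact: nbhs_left_lt.
move=> /filter_ex[s [s0 sb Ks]]; exists s; first by rewrite s0.
apply/seteqP; split=> // x [Fx usx]; have := usx; rewrite cut_gt0//= leNgt.
rewrite Ks//; split=> //; apply: cut_sub usx; by rewrite lexx ltW.
Unshelve. all: by end_near. Qed.

(** The set [F] of points at distance at least [e] from all of [cut u a] is closed and misses
    [cut u a], hence misses some lower cut [cut u s]; every cut in between is then within [e] of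
    [cut u a]. *)
Lemma cut_left_continuous u a (e : R) : FB u -> 0 < a -> 0 < e ->
  exists2 s, 0 < s < a & forall z, s < z -> z <= a ->
  (hausdorff_dist (cut u a) (cut u z) <= e%:E)%E.
Proof.
move=> FBu a0 e0.
pose F := \bigcap_(x in cut u a) [set y | e <= edist x y].
have [||s sa Fs] := @cut_disjoint_left u F a FBu _ a0.
- by apply: closed_bigI => x _; exact: closed_edist_ge.
- apply/seteqP; split=> // x [Fx ux]; have := Fx x ux.
  by rewrite /= edistxx leNgt e0.
exists s => // z sz za; have /andP[s0 _] := sa.
apply: hausdorff_dist_le => [x ux|x ux].
  exists x; last by rewrite edistxx ltW.
  by apply: cut_sub ux; rewrite za (ltW (lt_trans s0 sz)).
have ux' : cut u s x by apply: cut_sub ux; rewrite !ltW.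
have : ~ F x by move=> Fx; have : set0 x by rewrite -Fs.
move=> /existsNP[y /not_implyP[uy /negP]]; rewrite -ltNge => yx.
by exists y => //; exact: ltW.
Qed.

(** A closed ball that misses [cut u a] already misses a slightly lower cut. Levels [z] above [a]
    are included, as cuts only shrink there. *)
Lemma lt_inf_edist_cut u (x : 'rV[R]_m) a (r : R) : FB u -> 0 < a ->
  (r%:E < ereal_inf [set (edist x y)%:E | y in cut u a])%E ->
  exists2 s, 0 < s < a & forall z, s < z ->
  (r%:E < ereal_inf [set (edist x y)%:E | y in cut u z])%E.
Proof.
move=> FBu a0 ri.
(* The intermediate radius [t] keeps the final inequality strict after passing to an infimum. *)
have [t rt ti] : exists2 t : R, r < t &
    (t%:E < ereal_inf [set (edist x y)%:E | y in cut u a])%E.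
  move: ri; case: ereal_inf => [i| |]//.
    by rewrite lte_fin => ri; exists ((r + i) / 2); rewrite ?lte_fin; lra.
  by move=> _; exists (r + 1); rewrite ?ltry//; lra.
have [||s sa Fs] := @cut_disjoint_left u [set y | edist x y <= t] a FBu _ a0.
- exact: closed_edist_le.
- apply/seteqP; split=> // y [/= yt uy]; move: ti; rewrite ltNge => /negP; apply.
  apply: le_trans (_ : (edist x y)%:E <= _)%E; last by rewrite lee_fin.
  by apply: ereal_inf_lbound; exists y.
exists s => // z sz; apply: (@lt_le_trans _ _ t%:E); first by rewrite lte_fin.
apply: le_ereal_inf_tmp => _ [y uy <-]; rewrite lee_fin leNgt; apply/negP => yt.
have : set0 y; last by [].
rewrite -Fs; split; first exact: ltW.
by have /andP[s0 _] := sa; apply: cut_sub uy; rewrite !ltW.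
Qed.

(** Exceeding [r] is witnessed by a single point of one set. Both alternatives measure the distance
    from that point, the form that [lt_inf_edist_cut] handles. *)
Lemma lt_hausdorff_distP (A B : set 'rV[R]_m) (r : \bar R) :
  (r < hausdorff_dist A B)%E <->
  (exists2 x, A x & r < ereal_inf [set (edist x y)%:E | y in B])%E \/
  (exists2 y, B y & r < ereal_inf [set (edist y x)%:E | x in A])%E.
Proof.
have EC y : [set (edist x y)%:E | x in A] = [set (edist y x)%:E | x in A].
  by apply: eq_imagel => x _; rewrite edistC.
rewrite /hausdorff_dist lt_max; split=> [/orP[|]|[|]].
- by move=> /ereal_sup_gt[_ [x Ax <-] rx]; left; exists x.
- by move=> /ereal_sup_gt[_ [y By <-] ry]; right; exists y; rewrite -?EC.
- move=> [x Ax rx]; apply/orP; left; apply: (lt_le_trans rx).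
  by apply: ereal_sup_ubound; exists x.
- move=> [y By ry]; apply/orP; right; apply: (lt_le_trans ry); rewrite -EC.
  by apply: ereal_sup_ubound; exists y.
Qed.

(* Each point of E lies in one of the intervals {x > q | ]q, x] c E}, q rational. *)
Lemma measurable_left_open (E : set R) :
  (forall x, E x -> exists2 y, y < x & `]y, x] `<=` E) -> measurable E.
Proof.
move=> Eopen.
pose I (q : rat) := [set x : R | ratr q < x /\ `]ratr q, x] `<=` E].
have -> : E = \bigcup_q I q.
  apply/seteqP; split=> [x Ex|x [q _ [qx]]]; last first.
    by apply; rewrite /= in_itv/= qx/=.
  have [y yx yE] := Eopen _ Ex; have [q] := rat_in_itvoo yx.
  rewrite in_itv/= => /andP[yq qx]; exists q => //; split=> // z /=.
  rewrite in_itv/= => /andP[qz zx]; apply: yE => /=.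
  by rewrite in_itv/= zx (lt_trans yq qz).
apply: bigcupT_measurable_rat => q; apply: is_interval_measurable.
move=> x y [qx _] [_ yE] z /andP[xz zy]; split; first exact: lt_le_trans xz.
move=> w /=; rewrite in_itv/= => /andP[qw wz]; apply: yE => /=.
by rewrite in_itv/= qw (le_trans wz).
Qed.

(** Superlevel sets are left-open: when the level decreases slightly, a witness stays in its growing
    cut, while its distance to the other cut stays above [r]. The bounds [h <= c] and [k <= c] keep
    the shifted levels positive. *)
Lemma measurable_hausdorff_cut u v h k c d : FB u -> FB v -> h <= c -> k <= c ->
  measurable_fun `]c, d]
    (fun a => hausdorff_dist (cut u (a - h)) (cut v (a - k))).
Proof.
move=> FBu FBv hc kc mD.
apply: (measurability _ (ErealGenOInfty.measurableE R)) => // _ [_ [r ->] <-].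
apply: measurable_left_open => x []; rewrite /= in_itv/= => /andP[cx xd].
rewrite in_itv/= andbT => /lt_hausdorff_distP[[y uy ry]|[y vy ry]].
- have [|s /andP[s0 sx] sP] := lt_inf_edist_cut FBv _ ry; first by lra.
  (* Above [s + k] the level [z - k] exceeds [s]; above [c] the point [z] stays in the domain. *)
  exists (Num.max (s + k) c); first by rewrite gt_max cx andbT; lra.
  move=> z /=; rewrite in_itv/= gt_max => /andP[/andP[sz cz] zx].
  rewrite !in_itv/= cz (le_trans zx xd) !andbT; split=> //.
  apply/lt_hausdorff_distP; left; exists y; last by apply: sP; lra.
  by apply: cut_sub uy; apply/andP; split; lra.
- have [|s /andP[s0 sx] sP] := lt_inf_edist_cut FBu _ ry; first by lra.
  exists (Num.max (s + h) c); first by rewrite gt_max cx andbT; lra.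
  move=> z /=; rewrite in_itv/= gt_max => /andP[/andP[sz cz] zx].
  rewrite !in_itv/= cz (le_trans zx xd) !andbT; split=> //.
  apply/lt_hausdorff_distP; right; exists y; last by apply: sP; lra.
  by apply: cut_sub vy; apply/andP; split; lra.
Qed.

End cuts.

(** * Translation of integrals, p-th powers and roots, finite families and filters *)

Section integral_tools.
Context {R : realType}.
Notation mu := (@lebesgue_measure R).
Local Open Scope ereal_scope.

(** Translation invariance, from uniqueness of the measure with given values on half-open
    intervals. *)
Lemma lebesgue_measure_shift (c : R) (A : set R) : measurable A ->
  pushforward mu ((fun x => x + c)%R : _ -> measurableTypeR R) A = mu A.
Proof.
have ms : measurable_fun [set: R] (fun x : R => (x + c)%R : measurableTypeR R).
  exact: measurable_funD.
move=> mA; apply/esym/lebesgue_measure_unique => //= _ [[a b]] _ <-.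
rewrite /pushforward.
have -> : ((fun x => x + c) @^-1` `]a, b] = `]a - c, b - c]%classic)%R.
  by apply/seteqP; split=> x /=; rewrite !in_itv/= ltrBlDr lerBrDr.
rewrite !lebesgue_measure_itv/= !lte_fin ltrD2r.
by rewrite !EFinB -!EFinB opprB addrA addrNK.
Qed.

Lemma ge0_integral_shift (c a b : R) (f : R -> \bar R) :
  measurable_fun `]a, b] f -> (forall x, `]a, b]%classic x -> 0 <= f x) ->
  \int[mu]_(x in `](a - c)%R, (b - c)%R]) f (x + c)%R =
  \int[mu]_(x in `]a, b]) f x.
Proof.
move=> mf f0.
rewrite (_ : `](a - c)%R, (b - c)%R]%classic =
    ((fun x => x + c)%R : _ -> measurableTypeR R) @^-1` `]a, b]); last first.
  by apply/seteqP; split=> x /=; rewrite !in_itv/= ltrBlDr lerBrDr.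
rewrite -ge0_integral_pushforward//=.
- apply: eq_measure_integral => [|mphi A mA _]; first exact: measurable_funD.
  exact: lebesgue_measure_shift.
- exact: measurable_funD.
- by move=> x; rewrite inE; exact: f0.
Qed.

Lemma powRVK (p x : R) : (0 < p)%R -> (0 < x)%R -> ((x `^ p^-1) `^ p)%R = x.
Proof. by move=> p0 x0; rewrite -powRrM mulVf ?gt_eqF// powRr1// ltW. Qed.

Lemma poweR_le (p : R) (x y : \bar R) : (0 <= p)%R -> 0 <= x -> x <= y ->
  x `^ p <= y `^ p.
Proof.
move=> p0 x0 xy; apply: gt0_ler_poweR => //; rewrite in_itv/= leey andbT//.
exact: le_trans xy.
Qed.

Lemma poweRK (p : R) (x : \bar R) : (0 < p)%R -> 0 <= x -> (x `^ p^-1) `^ p = x.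
Proof. by move=> p0 x0; rewrite -poweRrM mulVf ?gt_eqF// poweRe1. Qed.

Lemma poweRVK (p : R) (x : \bar R) : (0 < p)%R -> 0 <= x -> (x `^ p) `^ p^-1 = x.
Proof. by move=> p0 x0; rewrite -poweRrM mulfV ?gt_eqF// poweRe1. Qed.

(** Removes the outer root of [dp]; the values stay extended because the integrals are not known to
    be finite beforehand. *)
Lemma poweRV_le (p : R) (x y : \bar R) : (0 < p)%R -> 0 <= x -> 0 <= y ->
  (x `^ p^-1 <= y) = (x <= y `^ p).
Proof.
move=> p0 x0 y0; apply/idP/idP => xy.
  by rewrite -(poweRK p0 x0); apply: poweR_le (ltW p0) (poweR_ge0 _ _) xy.
by rewrite -(poweRVK p0 y0); apply: poweR_le => //; rewrite invr_ge0 ltW.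
Qed.

Lemma poweRV_lt (p : R) (x y : \bar R) : (0 < p)%R -> 0 <= x -> 0 <= y ->
  (x `^ p^-1 < y) = (x < y `^ p).
Proof.
move=> p0 x0 y0; apply/idP/idP; apply: contraTT; rewrite -!leNgt => xy.
  by rewrite -(poweRVK p0 y0); apply: poweR_le; rewrite ?invr_ge0 ?poweR_ge0// ltW.
by rewrite -(poweRK p0 x0); apply: poweR_le => //; exact: ltW.
Qed.

(** The sum is at most three times the maximum [M], and the p-th power of [M] is one of the three
    summands. *)
Lemma poweR_le3 (p : R) (x a b c : \bar R) : (0 <= p)%R ->
  0 <= x -> 0 <= a -> 0 <= b -> 0 <= c -> x <= a + b + c ->
  x `^ p <= (3 `^ p)%:E * (a `^ p + b `^ p + c `^ p).
Proof.
move=> p0 x0 a0 b0 c0 xabc; pose M := Order.max a (Order.max b c).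
have [aM bM cM] : [/\ a <= M, b <= M & c <= M].
  by rewrite /M !le_max !lexx !orbT.
have M0 : 0 <= M by apply: le_trans aM.
have xM : x <= 3%:E * M.
  apply: (le_trans xabc); rewrite (_ : 3%:E = 1 + 1 + 1 :> \bar R); last first.
    by rewrite -!EFinD; congr EFin; ring.
  by rewrite !ge0_muleDl ?mul1e ?adde_ge0// !leeD.
apply: (le_trans (poweR_le p0 x0 xM)).
rewrite poweRM ?lee_fin// poweR_EFin lee_wpmul2l ?lee_fin ?powR_ge0//.
have [pa pb pc] : [/\ 0 <= a `^ p, 0 <= b `^ p & 0 <= c `^ p].
  by rewrite !poweR_ge0.
rewrite /M /Order.max; case: ifP => _; [case: ifP => _|].
- by rewrite leeDr// adde_ge0.
- by rewrite -addeA addeCA leeDl// adde_ge0.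
- by rewrite -addeA leeDl// adde_ge0.
Qed.

(* A quasi-triangle inequality in L^p, in place of Minkowski's. *)
Lemma integral_poweR_le3 (p : R) (D : set R) (f a b c : R -> \bar R) :
  (0 <= p)%R -> measurable D -> measurable_fun D f ->
  measurable_fun D a -> measurable_fun D b -> measurable_fun D c ->
  (forall x, D x -> [/\ 0 <= f x, 0 <= a x, 0 <= b x & 0 <= c x]) ->
  (forall x, D x -> f x <= a x + b x + c x) ->
  \int[mu]_(x in D) (f x `^ p) <= (3 `^ p)%:E *
    (\int[mu]_(x in D) (a x `^ p) + \int[mu]_(x in D) (b x `^ p) +
     \int[mu]_(x in D) (c x `^ p)).
Proof.
move=> p0 mD mf ma mb mc ge0 fabc.
have mp g : measurable_fun D g -> measurable_fun D (fun x => g x `^ p).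
  by move=> mg; apply: (measurableT_comp (measurable_poweR p) mg).
have mab : measurable_fun D (fun x => a x `^ p + b x `^ p).
  by apply: emeasurable_funD; exact: mp.
have mabc : measurable_fun D (fun x => a x `^ p + b x `^ p + c x `^ p).
  by apply: emeasurable_funD => //; exact: mp.
apply: (@le_trans _ _ (\int[mu]_(x in D)
    ((3 `^ p)%:E * (a x `^ p + b x `^ p + c x `^ p)))).
  apply: ge0_le_integral => //.
  - by move=> x _; exact: poweR_ge0.
  - exact: mp.
  - exact: measurable_funeM.
  - by move=> x Dx; have [? ? ? ?] := ge0 x Dx; apply: poweR_le3 => //; exact: fabc.
rewrite ge0_integralZl//; last first.
  by move=> x Dx; rewrite !adde_ge0 ?poweR_ge0.
rewrite ge0_integralD//; last 3 first.
- by move=> x Dx; rewrite adde_ge0 ?poweR_ge0.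
- by move=> x Dx; rewrite poweR_ge0.
- exact: mp.
rewrite ge0_integralD//.
- by move=> x Dx; rewrite poweR_ge0.
- exact: mp.
- by move=> x Dx; rewrite poweR_ge0.
- exact: mp.
Qed.

Lemma ereal_cvg0 (f : (\bar R)^nat) :
  (forall e : R, (0 < e)%R -> \forall n \near \oo, 0 <= f n <= e%:E) ->
  f @ \oo --> 0.
Proof.
move=> f0; apply/fine_cvgP; split.
  have := f0 _ ltr01; apply: filterS => n /andP[fn0 fn1].
  by rewrite ge0_fin_numE// (le_lt_trans fn1)// ltry.
apply/cvgr0Pnorm_le => e e0; have := f0 _ e0; apply: filterS => n /andP[fn0 fne].
rewrite /= ger0_norm ?fine_ge0// -lee_fin fineK// ge0_fin_numE//.
by rewrite (le_lt_trans fne)// ltry.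
Qed.

(** Gives one bound, or one threshold, valid for all centers of a finite net. *)
Lemma near_finite_set (T I : Type) (F : set_system I) (S : set T)
    (P : T -> I -> Prop) : Filter F -> finite_set S ->
  (forall v, S v -> \forall i \near F, P v i) ->
  \forall i \near F, forall v, S v -> P v i.
Proof.
move=> FF /(@finite_seqP {classic T})[s ->]; elim: s => [_|v s IH vP].
  by apply: nearW => i v; rewrite /= in_nil.
have Pv : \forall i \near F, P v i by apply: vP; rewrite /= mem_head.
have Ps : \forall i \near F, forall w, [set` s] w -> P w i.
  by apply: IH => w ws; apply: vP; rewrite /= in_cons; apply/orP; right.
apply: filterS2 Pv Ps => i Pvi Psi w; rewrite /= in_cons => /predU1P[->//|].
exact: Psi.
Qed.

End integral_tools.

(** * The p-mean metric on [FB], and left continuity in p-mean of a single fuzzy set *)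

Section fuzzy_sets.
Context {R : realType} {m : nat}.
Notation mu := (@lebesgue_measure R).
Implicit Types (u v w : 'rV[R]_m -> R) (a b c d h : R).

Lemma cut_hat0 a : 0 < a <= 1 -> cut (@hat0 R m) a = [set 0].
Proof.
move=> /andP[a0 a1]; rewrite cut_gt0//; apply/seteqP; split=> x /=.
  rewrite /hat0 indicE; case: (boolP (x \in [set 0])) => [|_]; first by rewrite inE.
  by move/(lt_le_trans a0); rewrite ltxx.
by move=> ->; rewrite /hat0 indicE mem_set.
Qed.

Lemma FB_hat0 : FB (@hat0 R m).
Proof.
have c0 : closed [set (0 : 'rV[R]_m)] by apply: accessible_closed_set1; exact: hausdorff_accessible.
split.
- by move=> x; rewrite /hat0 indicE; case: (_ \in _); rewrite /= ?lexx ?ler01.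
- by exists 0; rewrite /hat0 indicE mem_set.
- move=> x a; rewrite /hat0 indicE; case: (boolP (x \in _)) => x0 /= xa.
    by near=> y; rewrite indicE; apply: le_lt_trans xa; case: (_ \in _).
  have near_x : \forall y \near x, (~` [set (0 : 'rV[R]_m)]) y.
    apply: open_nbhs_nbhs; split; first exact: closed_openC.
    by move/negP: x0; rewrite inE.
  near=> y; rewrite indicE memNset//.
  by near: y.
- have -> : cut (@hat0 R m) 0 = [set 0].
    rewrite /cut eqxx (_ : [set x | 0 < hat0 x] = [set (0 : 'rV[R]_m)]).
      by rewrite -(closure_id _).1.
    apply/seteqP; split=> x /=; rewrite /hat0 indicE.
      by case: (boolP (x \in _)) => [|_]; rewrite ?inE//= ltxx.
    by move=> ->; rewrite mem_set.
  exists 0; split=> // M M0 x /= ->; by rewrite normr0 ltW.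
Unshelve. all: by end_near. Qed.

Lemma hausdorff_cut_bounded u v : FB u -> FB v ->
  exists2 C : R, 0 <= C & forall a b, 0 <= a <= 1 -> 0 <= b <= 1 ->
  (hausdorff_dist (cut u a) (cut v b) <= C%:E)%E.
Proof.
move=> FBu FBv; have [C C0 uC] := FB_bounded FBu; have [D D0 vD] := FB_bounded FBv.
exists (C + D) => [|a b a01 b01]; first exact: addr_ge0.
have [/andP[a0 _] /andP[b0 _]] := (a01, b01).
have [[x ux] [y vy]] := (cut_neq0 FBu a01, cut_neq0 FBv b01).
have le x' y' : cut u a x' -> cut v b y' -> edist x' y' <= C + D.
  move=> ux' vy'; apply: le_trans (edist_triangle 0 _ _) _.
  by apply: lerD; [exact: uC ux'|rewrite edistC; exact: vD vy'].
apply: hausdorff_dist_le => [x' ux'|y' vy'].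
  by exists y => //; exact: le.
by exists x => //; exact: le.
Qed.

Local Open Scope ereal_scope.

Lemma measurable_hausdorff_cut0 u v c d : FB u -> FB v -> (0 <= c)%R ->
  measurable_fun `]c, d] (fun a => hausdorff_dist (cut u a) (cut v a)).
Proof.
move=> FBu FBv c0.
have := @measurable_hausdorff_cut _ _ u v 0%R 0%R c d FBu FBv c0 c0.
by under [X in measurable_fun _ X]eq_fun do rewrite ?subr0.
Qed.

Lemma measurable_hausdorff_cutB u v c d : FB u -> FB v -> (0 <= c)%R ->
  measurable_fun `]c, d] (fun a => hausdorff_dist (cut u a) (cut v (a - c)%R)).
Proof.
move=> FBu FBv c0.
have := @measurable_hausdorff_cut _ _ u v 0%R c c d FBu FBv c0 (lexx c).
by under [X in measurable_fun _ X]eq_fun do rewrite ?subr0.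
Qed.

Lemma measurable_fun_poweR (D : set R) (f : R -> \bar R) (p : R) :
  measurable_fun D f -> measurable_fun D (fun x => f x `^ p).
Proof. by move=> mf; apply: (measurableT_comp (measurable_poweR p) mf). Qed.

(* The endpoint [h], where the cut at level 0 is a closure, is negligible. *)
Lemma integral_hausdorff_cutB u v h (p : R) : FB u -> FB v -> (0 <= h)%R ->
  \int[mu]_(a in `[h, 1%R]) (hausdorff_dist (cut u a) (cut v (a - h)%R) `^ p) =
  \int[mu]_(a in `]h, 1%R]) (hausdorff_dist (cut u a) (cut v (a - h)%R) `^ p).
Proof.
move=> FBu FBv h0; rewrite -integral_itv_obnd_cbnd//.
by apply: measurable_fun_poweR; exact: measurable_hausdorff_cutB.
Qed.

Lemma dpE (p : R) u v : FB u -> FB v -> dp p u v =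
  (\int[mu]_(a in `]0%R, 1%R]) (hausdorff_dist (cut u a) (cut v a) `^ p)) `^ p^-1.
Proof.
move=> FBu FBv; rewrite /dp -integral_itv_obnd_cbnd//.
by apply: measurable_fun_poweR; exact: measurable_hausdorff_cut0.
Qed.

Lemma integral_poweR_ge0 (D : set R) (f : R -> \bar R) (p : R) :
  0 <= \int[mu]_(a in D) (f a `^ p).
Proof. by apply: integral_ge0 => a _; exact: poweR_ge0. Qed.

Lemma dp_lt (p e : R) u v : FB u -> FB v -> (0 < p)%R -> (0 < e)%R ->
  (dp p u v < e%:E) =
  (\int[mu]_(a in `]0%R, 1%R]) (hausdorff_dist (cut u a) (cut v a) `^ p)
    < (e `^ p)%:E).
Proof.
move=> FBu FBv p0 e0; rewrite dpE// poweRV_lt//; first exact: integral_poweR_ge0.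
by rewrite lee_fin ltW.
Qed.

Lemma dp_hat0_le (p M : R) u : FB u -> (0 < p)%R -> (0 < M)%R ->
  (dp p u (@hat0 R m) <= M%:E) =
  (\int[mu]_(a in `]0%R, 1%R]) (hausdorff_dist (cut u a) [set 0%R] `^ p)
    <= (M `^ p)%:E).
Proof.
move=> FBu p0 M0; rewrite dpE//; last exact: FB_hat0.
have -> : \int[mu]_(a in `]0%R, 1%R])
      (hausdorff_dist (cut u a) (cut (@hat0 R m) a) `^ p) =
    \int[mu]_(a in `]0%R, 1%R]) (hausdorff_dist (cut u a) [set 0%R] `^ p).
  by apply: eq_integral => a; rewrite inE/= in_itv/= => a01; rewrite cut_hat0.
have M0' : 0 <= M%:E by rewrite lee_fin ltW.
by rewrite (poweRV_le p0 (integral_poweR_ge0 _ _ _) M0').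
Qed.

Lemma measurable_hausdorff_set0 u c d : FB u -> (0 <= c)%R -> (d <= 1)%R ->
  measurable_fun `]c, d] (fun a => hausdorff_dist (cut u a) [set 0%R]).
Proof.
move=> FBu c0 d1.
apply: (eq_measurable_fun (fun a => hausdorff_dist (cut u a) (cut (@hat0 R m) a))).
  move=> a; rewrite inE/= in_itv/= => /andP[ca ad].
  by rewrite cut_hat0// (le_lt_trans c0 ca) (le_trans ad).
by apply: measurable_hausdorff_cut0 => //; exact: FB_hat0.
Qed.

(** Dominated convergence concerns sequences, hence the argument by contradiction along shifts
    [h_ n] tending to 0. The conclusion is phrased with a filter in order to feed
    [near_finite_set]. *)
Lemma mean_left_continuous (p : R) u : (0 < p)%R -> FB u ->
  forall e : R, (0 < e)%R -> \forall d \near 0%R^'+, forall h, (0 <= h < d)%R ->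
  \int[mu]_(a in `]h, 1%R]) (hausdorff_dist (cut u a) (cut u (a - h)%R) `^ p)
    < e%:E.
Proof.
move=> p0 FBu e e0.
suff [d d0 dP] : exists2 d : R, (0 < d)%R & forall h, (0 <= h < d)%R ->
    \int[mu]_(a in `]h, 1%R]) (hausdorff_dist (cut u a) (cut u (a - h)%R) `^ p)
    < e%:E.
  have := nbhs_right_lt d0; apply: filterS => c cd h /andP[h0 hc].
  by apply: dP; rewrite h0/= (lt_trans hc).
apply: contrapT => noe.
pose f h a := hausdorff_dist (cut u a) (cut u (a - h)%R) `^ p.
have bad n : exists h, (0 <= h < n.+1%:R^-1)%R /\
    e%:E <= \int[mu]_(a in `]h, 1%R]) f h a.
  apply: contrapT => no; apply: noe; exists n.+1%:R^-1%R; first by rewrite invr_gt0.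
  move=> h hn; rewrite ltNge; apply/negP => eh; apply: no; by exists h.
have [h_ hP] := choice bad.
(* Extension by zero gives all integrands the common domain ]0, 1]. *)
pose f_ n := f (h_ n) \_ `](h_ n), 1%R].
have h_ge0 n : (0 <= h_ n)%R by have [/andP[]] := hP n.
have D_ n : `]0%R, 1%R] `&` `](h_ n), 1%R] = `](h_ n), 1%R]%classic.
  apply/setIidr => a /=; rewrite !in_itv/= => /andP[ha ->].
  by rewrite (le_lt_trans _ ha).
have [C C0 uC] := hausdorff_cut_bounded FBu FBu.
have fC h a : (0 <= h)%R -> (h < a <= 1)%R -> f h a <= (C `^ p)%:E.
  move=> h0 /andP[ha a1]; rewrite -poweR_EFin; apply: poweR_le; first exact: ltW.
    by apply: hausdorff_dist_ge0; apply: cut_neq0 => //; apply/andP; split; lra.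
  by apply: uC; apply/andP; split; lra.
have f_ge0 n a : 0 <= f_ n a.
  by rewrite /f_ patchE; case: ifP => // _; exact: poweR_ge0.
have mf_ n : measurable_fun `]0%R, 1%R : R] (f_ n).
  apply/(measurable_restrict (f (h_ n))) => //; rewrite D_.
  by apply: measurable_fun_poweR; exact: measurable_hausdorff_cutB.
have f_C n a : `]0%R, 1%R]%classic a -> `|f_ n a| <= (C `^ p)%:E.
  move=> _; rewrite gee0_abs// /f_ patchE; case: ifPn => [|_].
    by rewrite inE/= in_itv/=; exact: fC.
  by rewrite lee_fin powR_ge0.
have f_0 a : `]0%R, 1%R]%classic a -> f_ ^~ a @ \oo --> 0.
  rewrite /= in_itv/= => /andP[a0 a1]; apply: ereal_cvg0 => c c0.
  (* A distance of at most [c'] has p-th power at most [c]. *)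
  pose c' := (c `^ p^-1)%R; have c'0 : (0 < c')%R by rewrite powR_gt0.
  have [s /andP[s0 sa] sP] := cut_left_continuous FBu a0 c'0.
  have [N _ NP] : \forall n \near \oo, (n.+1%:R^-1 < a - s)%R.
    have sa0 : (0 < a - s)%R by rewrite subr_gt0.
    exact: near_infty_natSinv_lt (PosNum sa0).
  near=> n; rewrite f_ge0 /= /f_ patchE; case: ifPn => [|_]; last by rewrite lee_fin ltW.
  rewrite inE/= in_itv/= => /andP[ha _].
  have hn : (h_ n < a - s)%R.
    have [/andP[_ hn] _] := hP n; apply: lt_trans hn _.
    by apply: NP; near: n; exact: nbhs_infty_ge.
  have -> : c%:E = c'%:E `^ p.
    by rewrite poweR_EFin powRVK.
  apply: poweR_le; first exact: ltW.
    by apply: hausdorff_dist_ge0; apply: cut_neq0 => //; rewrite ltW.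
  by apply: sP; have := h_ge0 n; lra.
have iC : mu.-integrable `]0%R, 1%R] (cst (C `^ p)%:E).
  apply/integrableP; split=> //.
  rewrite (eq_integral (cst (C `^ p)%:E)); last first.
    by move=> a _; rewrite gee0_abs// lee_fin powR_ge0.
  by rewrite integral_cst//= lebesgue_measure_itv/= lte_fin ltr01 sube0 mule1 ltry.
have [||_ _] := @dominated_convergence _ _ _ mu _ (measurable_itv _) f_ (cst 0)
  (cst (C `^ p)%:E) mf_ (measurable_cst _) _ iC.
- by apply: aeW => a a01; exact: f_0.
- by apply: aeW => a n a01; exact: f_C.
rewrite integral0 => cvg0.
have : e%:E <= limn (fun n => \int[mu]_(a in `]0%R, 1%R]) f_ n a).
  apply: lime_ge; first by apply/cvg_ex; exists 0.
  apply: nearW => n; have [_ /le_trans] := hP n; apply.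
  by rewrite /f_ -integral_mkcondr D_.
by rewrite (cvg_lim _ cvg0)// lee_fin leNgt e0.
Unshelve. all: by end_near. Qed.

End fuzzy_sets.

(** * Totally bounded sets *)

Section necessity.
Context {R : realType} {m : nat}.
Notation mu := (@lebesgue_measure R).
Implicit Types (u v : 'rV[R]_m -> R) (a b c d h : R).
Local Open Scope ereal_scope.

Lemma integral_cst_itv c d (x : \bar R) : (c <= d)%R ->
  \int[mu]_(a in `]c, d]) x = x * (d - c)%:E.
Proof.
move=> cd; rewrite integral_cst//= lebesgue_measure_itv/= lte_fin.
case: ltP => [_|dc]; first by rewrite EFinB.
by have -> : c = d; [apply/eqP; rewrite eq_le cd|rewrite subrr].
Qed.

Lemma hausdorff_cut_ge0 u a (B : set 'rV[R]_m) : FB u -> (0 <= a <= 1)%R ->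
  0 <= hausdorff_dist (cut u a) B.
Proof. by move=> FBu a01; apply: hausdorff_dist_ge0; exact: cut_neq0. Qed.

Lemma totally_bounded_p_mean_bounded (p : R) (X U : set ('rV[R]_m -> R)) :
  (0 < p)%R -> X `<=` @FB R m -> U `<=` X ->
  totally_bounded_in (dp p) X U -> p_mean_bounded p U.
Proof.
move=> p0 XFB UX /(_ 1%R ltr01)[S [finS SX cov]].
have C_ge0 : \forall C \near +oo%R, (0 <= C :> R)%R.
  exact: nbhs_pinfty_ge (num_real 0).
have C_bound : \forall C \near +oo%R, forall v, S v ->
    forall a, (0 < a <= 1)%R -> hausdorff_dist (cut v a) [set 0%R] <= C%:E.
  apply: near_finite_set => // v Sv.
  have [C C0 vC] := hausdorff_cut_bounded (XFB _ (SX _ Sv)) (@FB_hat0 R m).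
  have := nbhs_pinfty_ge (num_real C); apply: filterS => D CD a a01.
  rewrite -(cut_hat0 a01); have /andP[a0 a1] := a01.
  by apply: (le_trans (vC _ _ _ _)); rewrite ?lee_fin// (ltW a0).
have [C [C0 SC]] := filter_ex (filterI C_ge0 C_bound).
(* Inside the bracket, 1 comes from the net of radius 1 and the p-th power of [C] from the centers;
   the third term of the three-term inequality is taken to be zero. *)
pose L := (3 `^ p * (1 + C `^ p))%R.
have L0 : (0 < L)%R.
  by rewrite mulr_gt0 ?powR_gt0// ltr_wpDr// powR_ge0.
exists (L `^ p^-1)%R; first exact: powR_gt0.
move=> u Uu; have FBu := XFB _ (UX _ Uu); have [v Sv] := cov u Uu.
have FBv := XFB _ (SX _ Sv).
rewrite dp_lt// powR1 => uv1; rewrite dp_hat0_le ?powR_gt0// powRVK//.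
apply: (le_trans (@integral_poweR_le3 _ p _ _
  (fun a => hausdorff_dist (cut u a) (cut v a)) (cst C%:E) (cst 0)
  (ltW p0) (measurable_itv _) _ _ _ _ _ _)) => //.
- exact: measurable_hausdorff_set0.
- exact: measurable_hausdorff_cut0.
- move=> a /=; rewrite in_itv/= => /andP[a0 a1].
  by rewrite !hausdorff_cut_ge0 ?lee_fin// (ltW a0).
- move=> a /=; rewrite in_itv/= => /andP[a0 a1]; rewrite adde0.
  apply: (le_trans (hausdorff_dist_triangle (B := cut v a) _ _ _)).
  + by apply: cut_neq0 => //; rewrite (ltW a0).
  + by apply: cut_neq0 => //; rewrite (ltW a0).
  + by rewrite leeD2l// SC// a0.
rewrite /= !integral_cst_itv// subr0 !mule1 powR0 ?gt_eqF// adde0.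
rewrite /L EFinM EFinD lee_wpmul2l ?lee_fin ?powR_ge0// leeD2r//.
exact: ltW.
Qed.

(** The path goes from the cut of [u] at a to that of a center [v] at a, then to [v] at a - h, then
    back to [u] at a - h. *)
Lemma totally_bounded_equi_left_continuous (p : R) (X U : set ('rV[R]_m -> R)) :
  (0 < p)%R -> X `<=` @FB R m -> U `<=` X ->
  totally_bounded_in (dp p) X U -> p_mean_equi_left_continuous p U.
Proof.
move=> p0 XFB UX tbU e e0.
pose K := (3 `^ p)%R; have K0 : (0 < K)%R by exact: powR_gt0.
have ep0 : (0 < e `^ p)%R by exact: powR_gt0.
pose t := (e `^ p / (4 * K))%R; have t0 : (0 < t)%R by rewrite divr_gt0 ?mulr_gt0.
have [S [finS SX cov]] := tbU (t `^ p^-1)%R (powR_gt0 _ t0).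
have near_d : \forall d \near 0%R^'+, forall v, S v -> forall h, (0 <= h < d)%R ->
    \int[mu]_(a in `]h, 1%R]) (hausdorff_dist (cut v a) (cut v (a - h)%R) `^ p)
    < t%:E.
  apply: near_finite_set => // v Sv.
  by apply: mean_left_continuous => //; exact: XFB (SX _ Sv).
have d_gt0 := @nbhs_right_gt R 0; have d_le1 := nbhs_right_le (@ltr01 R).
have [d [d0 [d1 dP]]] := filter_ex (filterI d_gt0 (filterI d_le1 near_d)).
exists d => // h hd u Uu.
have /andP[h0 hltd] := hd; have h1 : (h <= 1)%R by lra.
have FBu := XFB _ (UX _ Uu); have [v Sv uvt] := cov u Uu.
have FBv := XFB _ (SX _ Sv).
rewrite (dp_lt FBu FBv p0 (powR_gt0 _ t0)) (powRVK p0 t0) in uvt.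
rewrite integral_hausdorff_cutB// poweRV_lt ?lee_fin ?(ltW e0)//; last first.
  exact: integral_poweR_ge0.
apply: (@le_lt_trans _ _ (K%:E * (t%:E + t%:E + t%:E))); last first.
  rewrite -!EFinD -EFinM poweR_EFin lte_fin.
  have -> : (K * (t + t + t) = 3 / 4 * e `^ p)%R.
    by rewrite /t; field; rewrite gt_eqF.
  lra.
have sub01 c d' : (0 <= c)%R -> (d' <= 1)%R ->
    \int[mu]_(a in `]c, d']) (hausdorff_dist (cut u a) (cut v a) `^ p) <= t%:E.
  move=> c0 d'1; apply: le_trans (ltW uvt); apply: ge0_subset_integral => //.
  - by apply: measurable_fun_poweR; exact: measurable_hausdorff_cut0.
  - by move=> a _; exact: poweR_ge0.
  - move=> a /=; rewrite !in_itv/= => /andP[ca ad].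
    by rewrite (le_lt_trans c0 ca) (le_trans ad).
apply: (le_trans (@integral_poweR_le3 _ p _ _
  (fun a => hausdorff_dist (cut u a) (cut v a))
  (fun a => hausdorff_dist (cut v a) (cut v (a - h)%R))
  (fun a => hausdorff_dist (cut u (a - h)%R) (cut v (a - h)%R))
  (ltW p0) (measurable_itv _) _ _ _ _ _ _)) => //.
- exact: measurable_hausdorff_cutB.
- exact: measurable_hausdorff_cut0.
- exact: measurable_hausdorff_cutB.
- exact: measurable_hausdorff_cut.
- move=> a /=; rewrite in_itv/= => /andP[ha a1].
  by rewrite !hausdorff_cut_ge0//; apply/andP; split; lra.
- move=> a /=; rewrite in_itv/= => /andP[ha a1].
  have [a01 ah01] : (0 <= a <= 1)%R /\ (0 <= a - h <= 1)%R.
    by split; apply/andP; split; lra.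
  have [una vna] := (cut_neq0 FBu a01, cut_neq0 FBv a01).
  have vnah := cut_neq0 FBv ah01.
  rewrite -addeA; apply: (le_trans (hausdorff_dist_triangle (B := cut v a) _ una vna)).
  rewrite leeD2l// [X in _ + X]hausdorff_distC.
  exact: hausdorff_dist_triangle.
rewrite lee_wpmul2l ?lee_fin ?powR_ge0//; apply: leeD; first apply: leeD.
- exact: sub01.
- by apply/ltW; exact: dP Sv _ hd.
(* Translated by [h], the last term is part of the integral that defines the distance from [u] to
   [v]. *)
- rewrite -(ge0_integral_shift h).
  + under eq_integral do rewrite addrK.
    by rewrite subrr; apply: sub01; lra.
  + by apply: measurable_fun_poweR; exact: measurable_hausdorff_cut.
  + by move=> a _; exact: poweR_ge0.
Qed.

End necessity.

(** * Finite nets *)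

Section sufficiency.
Context {R : realType} {m : nat}.
Notation mu := (@lebesgue_measure R).
Implicit Types (u v : 'rV[R]_m -> R) (a b c d h : R).

Lemma finite_cell_map (rho e : R) : 0 < e ->
  exists (T : finType) (cell : 'rV[R]_m -> T), forall x y : 'rV[R]_m,
  edist x 0 <= rho -> edist y 0 <= rho -> cell x = cell y -> edist x y <= e.
Proof.
(* Cubes of side [s] have diameter at most m s <= e; the successor avoids a division by zero. *)
move=> e0; pose s := e / m.+1%:R.
have s0 : 0 < s by rewrite divr_gt0.
pose K := Num.truncn ((rho + rho) / s).
pose t (x : 'rV[R]_m) i := Num.truncn ((x ord0 i + rho) / s).
(* Coordinates are translated by [rho] to be nonnegative, then rounded down to a multiple of [s].
   Indices out of range fall on the default of [inord]; this is harmless, as only points of the ball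
   are compared. *)
exists {ffun 'I_m -> 'I_K.+1}, (fun x => [ffun i => inord (t x i)]).
move=> x y xrho yrho /ffunP xy.
have ge0 (z : 'rV[R]_m) i : edist z 0 <= rho -> 0 <= (z ord0 i + rho) / s.
  move=> /(le_trans (coord_le_edist z 0 i)); rewrite mxE subr0 ler_norml.
  by move=> /andP[zrho _]; rewrite divr_ge0 ?(ltW s0)//; lra.
have tK (z : 'rV[R]_m) i : edist z 0 <= rho -> (t z i < K.+1)%N.
  move=> /(le_trans (coord_le_edist z 0 i)); rewrite mxE subr0 ler_norml.
  by move=> /andP[_ zrho]; rewrite ltnS le_truncn// ler_pM2r ?invr_gt0// lerD2r.
apply: (@le_trans _ _ (m%:R * s)); last first.
  by rewrite /s mulrCA ler_piMr ?(ltW e0)// ler_pdivrMr// mul1r ler_nat.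
apply: edist_le_coord => [|i]; first exact: ltW.
have txy : t x i = t y i.
  by have := congr1 val (xy i); rewrite !ffunE/= !inordK ?tK.
have /andP[] := truncn_itv (ge0 x i xrho).
have /andP[] := truncn_itv (ge0 y i yrho).
rewrite -!/(t _ _) txy -natr1 ler_pdivlMr// ler_pdivlMr// ltr_pdivrMr// ltr_pdivrMr//.
by rewrite !mulrDl !mul1r ler_norml => *; apply/andP; split; lra.
Qed.

(** The code of [u] is the set of pairs (k, cell) such that the cut at level k h meets the cell. The
    ball hypotheses are required level by level, since no common [rho] is available at k = 0. *)
Lemma finite_cut_code (rho e h : R) (N : nat) : 0 < e ->
  exists (T : finType) (code : ('rV[R]_m -> R) -> T), forall u v,
  code u = code v -> forall k, (k < N)%N ->
  (forall x, cut u (k%:R * h) x -> edist x 0 <= rho) ->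
  (forall x, cut v (k%:R * h) x -> edist x 0 <= rho) ->
  (hausdorff_dist (cut u (k%:R * h)) (cut v (k%:R * h)) <= e%:E)%E.
Proof.
move=> e0; have [T [cell cellP]] := finite_cell_map rho e0.
exists {set 'I_N * T}, (fun u => [set kg : 'I_N * T |
  `[< exists2 x, cut u (kg.1%:R * h) x & cell x = kg.2 >]]%SET).
move=> u v /setP uv k kN urho vrho.
have cellE x : (exists2 y, cut u (k%:R * h) y & cell y = cell x) <->
               (exists2 y, cut v (k%:R * h) y & cell y = cell x).
  have := uv (Ordinal kN, cell x); rewrite !finset.inE/= => uvk.
  by split=> /asboolP ?; apply/asboolP; rewrite ?uvk// -uvk.
apply: hausdorff_dist_le => x.
- move=> ux; have [|y vy yx] := (cellE x).1; first by exists x.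
  by exists y => //; apply: cellP; [exact: urho|exact: vrho|].
- move=> vx; have [|y uy yx] := (cellE x).2; first by exists x.
  by exists y => //; apply: cellP; [exact: urho|exact: vrho|].
Qed.

(** Taking representatives inside [V] makes the centers members of U, hence of X, with no
    approximant to construct. *)
Lemma finite_representatives (A : Type) (T : finType) (code : A -> T) (V : set A) :
  exists S : set A, [/\ finite_set S, S `<=` V &
    forall x, V x -> exists2 y, S y & code x = code y].
Proof.
have [[x0 Vx0]|V0] := pselect (V !=set0); last first.
  by exists set0; split=> // x Vx; case: V0; exists x.
have pick t : exists y, V y /\ ((exists2 x, V x & code x = t) -> code y = t).
  have [[x Vx <-]|no] := pselect (exists2 x, V x & code x = t); first by exists x.
  by exists x0; split=> // /no.
have [c cP] := choice pick; exists (range c); split.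
- by apply: finite_image; exact: finite_finset.
- by move=> _ [t _ <-]; have [] := cP t.
- move=> x Vx; exists (c (code x)); first by exists (code x).
  by have [_ ->] := cP (code x); last exists x.
Qed.

Local Open Scope ereal_scope.

(** A Chebyshev-type bound: on ]0, h] every cut contains [cut u h], so the integrand is at least its
    value at [h]. *)
Lemma cut_radius_le (p h : R) u : (0 < p)%R -> FB u -> (0 < h <= 1)%R ->
  hausdorff_dist (cut u h) [set 0%R] `^ p * h%:E <=
  \int[mu]_(a in `]0%R, 1%R]) (hausdorff_dist (cut u a) [set 0%R] `^ p).
Proof.
move=> p0 FBu /andP[h0 h1].
have mN : measurable_fun `]0%R, 1%R : R]
    (fun a => hausdorff_dist (cut u a) [set 0%R] `^ p).
  by apply: measurable_fun_poweR; exact: measurable_hausdorff_set0.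
have sub : `]0%R, h] `<=` `]0%R, 1%R : R].
  by move=> a /=; rewrite !in_itv/= => /andP[-> /le_trans->].
rewrite -[h in h%:E]subr0 -integral_cst_itv ?(ltW h0)//.
apply: (@le_trans _ _
    (\int[mu]_(a in `]0%R, h]) (hausdorff_dist (cut u a) [set 0%R] `^ p))).
  apply: ge0_le_integral => //.
  - by move=> a _; exact: poweR_ge0.
  - exact: measurable_funS mN.
  - move=> a /=; rewrite in_itv/= => /andP[a0 ah]; apply: poweR_le (ltW p0) _ _.
      by apply: hausdorff_cut_ge0 => //; rewrite (ltW h0).
    apply: hausdorff_dist_set0_sub; last by apply: cut_sub; rewrite (ltW a0).
    by apply: cut_neq0 => //; rewrite (ltW h0).
by apply: ge0_subset_integral => // a _; exact: poweR_ge0.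
Qed.

Lemma equi_left_continuous_integral (p : R) (U : set ('rV[R]_m -> R)) :
  (0 < p)%R -> U `<=` @FB R m -> p_mean_equi_left_continuous p U ->
  forall t : R, (0 < t)%R -> exists2 d : R, (0 < d)%R &
  forall h, (0 <= h < d)%R -> forall u, U u ->
  \int[mu]_(a in `]h, 1%R]) (hausdorff_dist (cut u a) (cut u (a - h)%R) `^ p)
    <= t%:E.
Proof.
move=> p0 UFB equi t t0; have tp0 := powR_gt0 p^-1 t0.
have [d d0 dP] := equi _ tp0; exists d => // h hd u Uu.
have := dP h hd u Uu; rewrite integral_hausdorff_cutB ?(UFB _ Uu)//; last first.
- by have /andP[] := hd.
- exact: UFB.
- exact: UFB.
have tp0' : 0 <= (t `^ p^-1)%:E by rewrite lee_fin ltW.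
rewrite (poweRV_lt p0 (integral_poweR_ge0 _ _ _) tp0') poweR_EFin (powRVK p0 t0).
exact: ltW.
Qed.

(* A shift by a fixed h' moves ]0, h] to ]h', h + h'], where all the cuts lie in a
   common ball; the error of the shift is controlled by equi-left-continuity. *)
Lemma uniform_tail (p : R) (U : set ('rV[R]_m -> R)) : (0 < p)%R ->
  U `<=` @FB R m -> p_mean_bounded p U -> p_mean_equi_left_continuous p U ->
  forall t : R, (0 < t)%R -> exists2 h0 : R, (0 < h0)%R &
  forall h, (0 < h <= h0)%R -> forall u, U u ->
  \int[mu]_(a in `]0%R, h]) (hausdorff_dist (cut u a) [set 0%R] `^ p) <= t%:E.
Proof.
move=> p0 UFB [M M0 bM] equi t t0.
pose K := (3 `^ p)%R; have K0 : (0 < K)%R by exact: powR_gt0.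
(* Two nonzero terms of size [t'], times [K], add up to [t]. *)
pose t' := (t / (2 * K))%R; have t'0 : (0 < t')%R by rewrite divr_gt0 ?mulr_gt0.
have [d d0 dP] := equi_left_continuous_integral p0 UFB equi t'0.
pose L := (M `^ p)%R; have L0 : (0 < L)%R by exact: powR_gt0.
(* The shift must be below [d] for equi-left-continuity, and at most 1/2 so that h + h' <= 1
   whenever h <= h'. *)
pose h' := Num.min (d / 2)%R (2^-1)%R.
have h'0 : (0 < h')%R by rewrite lt_min; apply/andP; split; lra.
have h'd : (h' < d)%R by rewrite gt_min; apply/orP; left; lra.
have h'1 : (h' <= 2^-1)%R by rewrite ge_min lexx orbT.
have h01 : (0 < h' <= 1)%R by rewrite h'0 /=; lra.
(* By [cut_radius_le], the p-th power of the radius of [cut u h'] is at most L / h'; over a length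
   of at most h' t' / L its integral is at most [t']. *)
exists (Num.min h' (h' * (t' / L)))%R.
  by rewrite lt_min h'0 mulr_gt0// divr_gt0.
move=> h /andP[hgt0]; rewrite le_min => /andP[hh' hL] u Uu.
have FBu := UFB _ Uu.
have uL : \int[mu]_(a in `]0%R, 1%R]) (hausdorff_dist (cut u a) [set 0%R] `^ p) <= L%:E.
  by rewrite -(dp_hat0_le FBu p0 M0); exact: bM.
have itv01 a : `]0%R, h]%classic a -> [/\ (0 < a)%R, (a <= h)%R &
    (0 <= a <= 1)%R /\ (0 <= a + h' <= 1)%R].
  rewrite /= in_itv/= => /andP[a0 ah]; split=> //.
  by split; apply/andP; split; lra.
have h'01 : (0 <= h' <= 1)%R by rewrite (ltW h'0) /=; lra.
apply: (@le_trans _ _ (K%:E * (t'%:E + t'%:E + 0))); last first.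
  rewrite adde0 -EFinD -EFinM lee_fin.
  by have -> : (K * (t' + t') = t)%R; [rewrite /t'; field; rewrite gt_eqF|].
pose g x := hausdorff_dist (cut u (x - h')%R) (cut u x).
have mg c e : (h' <= c)%R -> measurable_fun `]c, e] g.
  move=> h'c; have := @measurable_hausdorff_cut _ _ u u h' 0%R c e FBu FBu h'c.
  move=> /(_ (le_trans (ltW h'0) h'c)).
  by under [X in measurable_fun _ X]eq_fun do rewrite subr0.
have mgh : measurable_fun `]0%R, h] (fun a => g (a + h')%R).
  (* Shifts are subtracted in [measurable_hausdorff_cut], so the level a + h' corresponds to the
     shift - h'. *)
  have := @measurable_hausdorff_cut _ _ u u 0%R (- h')%R 0%R h FBu FBu (lexx _).
  rewrite oppr_le0 => /(_ (ltW h'0)).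
  rewrite /g; under [X in measurable_fun _ X]eq_fun do rewrite subr0 opprK.
  by under [X in _ -> measurable_fun _ X]eq_fun do rewrite addrK.
apply: (le_trans (@integral_poweR_le3 _ p _ _ (fun a => g (a + h')%R)
  (cst (hausdorff_dist (cut u h') [set 0%R])) (cst 0)
  (ltW p0) (measurable_itv _) _ mgh (measurable_cst _) (measurable_cst _) _ _)).
- by apply: measurable_hausdorff_set0 => //; lra.
- move=> a /itv01[a0 ah [a01 ah01]]; split=> //.
  + exact: hausdorff_cut_ge0.
  + by rewrite /g addrK; exact: hausdorff_cut_ge0.
  + exact: hausdorff_cut_ge0.
- move=> a /itv01[a0 ah [a01 ah01]]; rewrite /g addrK adde0.
  apply: (le_trans (hausdorff_dist_triangle (B := cut u (a + h')%R) _ _ _)).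
  + exact: cut_neq0.
  + exact: cut_neq0.
  + apply: leeD2l; apply: hausdorff_dist_set0_sub; first exact: cut_neq0.
    by apply: cut_sub; rewrite (ltW h'0)/=; lra.
rewrite lee_wpmul2l ?lee_fin ?powR_ge0//; apply: leeD; first apply: leeD.
- have mgp c e : (h' <= c)%R -> measurable_fun `]c, e] (fun x => g x `^ p).
    by move=> h'c; apply: measurable_fun_poweR; exact: mg.
  have := @ge0_integral_shift _ h' h' (h + h')%R _ (mgp _ _ (lexx h'))
    (fun x _ => poweR_ge0 _ _).
  rewrite subrr addrK => ->.
  apply: (@le_trans _ _ (\int[mu]_(a in `]h', 1%R]) (g a `^ p))).
    apply: ge0_subset_integral => //; first exact: mgp.
      by move=> a _; exact: poweR_ge0.
    by move=> a /=; rewrite !in_itv/= => /andP[-> /le_trans->]//; lra.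
  have h'0d : (0 <= h' < d)%R by rewrite (ltW h'0).
  apply: le_trans (dP h' h'0d u Uu).
  rewrite le_eqVlt; apply/orP; left; apply/eqP.
  by apply: eq_integral => a _; rewrite /g hausdorff_distC.
- rewrite /= integral_cst_itv ?(ltW hgt0)// subr0.
  apply: (@le_trans _ _ (hausdorff_dist (cut u h') [set 0%R] `^ p *
      (h' * (t' / L))%:E)).
    by rewrite lee_wpmul2l ?poweR_ge0// lee_fin.
  rewrite EFinM muleA; apply: (@le_trans _ _ (L%:E * (t' / L)%:E)).
    have tL0 : 0 <= (t' / L)%:E by rewrite lee_fin ltW// divr_gt0.
    apply: (lee_wpmul2r tL0).
    exact: le_trans (cut_radius_le p0 FBu h01) uL.
  by rewrite -EFinM lee_fin mulrCA divff ?gt_eqF// mulr1.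
- by rewrite /= integral_cst_itv ?(ltW hgt0)// powR0 ?gt_eqF// mul0e.
Qed.

Lemma cut_uniformly_bounded (p h : R) (U : set ('rV[R]_m -> R)) : (0 < p)%R ->
  U `<=` @FB R m -> p_mean_bounded p U -> (0 < h <= 1)%R ->
  exists rho : R, forall u, U u -> forall a x, (h <= a)%R -> cut u a x ->
  (edist x 0 <= rho)%R.
Proof.
move=> p0 UFB [M M0 bM] h01; have /andP[h0 h1] := h01.
(* Solves r^p h = M^p, the extreme case allowed by [cut_radius_le]; the later + 1 supplies the
   strict bound that [hausdorff_dist_lt] needs. *)
pose r := ((M `^ p / h) `^ p^-1)%R.
have r0 : (0 < r)%R by rewrite powR_gt0// divr_gt0// powR_gt0.
exists (r + 1)%R => u Uu a x ha uax; have FBu := UFB _ Uu.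
have uh : hausdorff_dist (cut u h) [set 0%R] < (r + 1)%:E.
  apply: (@le_lt_trans _ _ r%:E); last by rewrite lte_fin ltrDl.
  have h01' : (0 <= h <= 1)%R by rewrite (ltW h0).
  have pV0 : (0 < p^-1)%R by rewrite invr_gt0.
  have H0 := hausdorff_cut_ge0 [set 0%R] FBu h01'.
  rewrite -(poweRVK p0 H0) /r -poweR_EFin; apply: poweR_le (ltW pV0) (poweR_ge0 _ _) _.
  rewrite EFinM lee_pdivlMr// (le_trans (cut_radius_le p0 FBu h01))//.
  by rewrite -(dp_hat0_le FBu p0 M0); exact: bM.
have uhx : cut u h x by apply: cut_sub uax; rewrite (ltW h0).
by have [y -> /ltW] := hausdorff_dist_lt uh uhx.
Qed.

(** The level [r] depends on [a], but on the right only the fixed shift [h] remains, thanks to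
    [hausdorff_dist_nestedl] applied to the cuts at a, r and a - h. *)
Lemma hausdorff_cut_le_grid (e h r a : R) u v : FB u -> FB v ->
  (0 <= a - h)%R -> (a - h <= r)%R -> (r <= a <= 1)%R ->
  hausdorff_dist (cut u r) (cut v r) <= e%:E ->
  hausdorff_dist (cut u a) (cut v a) <=
    hausdorff_dist (cut u a) (cut u (a - h)%R) + e%:E +
    hausdorff_dist (cut v a) (cut v (a - h)%R).
Proof.
move=> FBu FBv ah0 ahr /andP[ra a1] uvr.
have r01 : (0 <= r <= 1)%R by apply/andP; split; lra.
have a01 : (0 <= a <= 1)%R by apply/andP; split; lra.
have sub (w : 'rV[R]_m -> R) : cut w a `<=` cut w r /\ cut w r `<=` cut w (a - h)%R.
  by split; apply: cut_sub; apply/andP; split; lra.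
have [[ur ur'] [vr vr']] := (sub u, sub v).
have [una unr] := (cut_neq0 FBu a01, cut_neq0 FBu r01).
have vnr := cut_neq0 FBv r01.
apply: (le_trans (hausdorff_dist_triangle _ una unr)); rewrite -addeA.
apply: leeD; first exact: hausdorff_dist_nestedl.
apply: (le_trans (hausdorff_dist_triangle _ unr vnr)); apply: leeD => //.
by rewrite hausdorff_distC; exact: hausdorff_dist_nestedl.
Qed.

Lemma totally_bounded_of_mean (p : R) (X U : set ('rV[R]_m -> R)) :
  (0 < p)%R -> X `<=` @FB R m -> U `<=` X ->
  p_mean_bounded p U -> p_mean_equi_left_continuous p U ->
  totally_bounded_in (dp p) X U.
Proof.
move=> p0 XFB UX bU equi eps eps0; have UFB := subset_trans UX XFB.
pose K := (3 `^ p)%R; have K0 : (0 < K)%R by exact: powR_gt0.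
have ep0 : (0 < eps `^ p)%R by exact: powR_gt0.
(* Five nonzero terms of size [t] occur below, two for levels up to [h] and three above; the sixth
   share keeps the inequality strict. *)
pose t := (eps `^ p / (6 * K))%R; have t0 : (0 < t)%R by rewrite divr_gt0 ?mulr_gt0.
have [d d0 dP] := equi_left_continuous_integral p0 UFB equi t0.
have [h0 h00 hP] := uniform_tail p0 UFB bU equi t0.
pose h := Num.min (Num.min (d / 2)%R h0) 1%R.
have hgt0 : (0 < h)%R by rewrite !lt_min h00 ltr01 andbT; lra.
have hd : (h < d)%R by rewrite !gt_min; apply/orP; left; apply/orP; left; lra.
have hh0 : (h <= h0)%R by rewrite !ge_min lexx orbT.
have h1 : (h <= 1)%R by rewrite !ge_min lexx orbT.
have h01 : (0 < h <= 1)%R by rewrite hgt0.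
have [rho rhoP] := cut_uniformly_bounded p0 UFB bU h01.
pose e := (t `^ p^-1)%R; have e0 : (0 < e)%R by exact: powR_gt0.
(* Multiples k h that do not exceed 1 have k at most the integer part of 1 / h, hence the
   successor. *)
have [T [code codeP]] := finite_cut_code rho h (Num.truncn h^-1).+1 e0.
have [S [finS SU cov]] := finite_representatives code U.
exists S; split=> // [v /SU/UX//|u Uu]; have [v Sv uv] := cov u Uu.
exists v => //; have Uv := SU _ Sv; have [FBu FBv] := (UFB _ Uu, UFB _ Uv).
rewrite (dp_lt FBu FBv p0 eps0).
pose H a := hausdorff_dist (cut u a) (cut v a).
have mH c e' : (0 <= c)%R -> measurable_fun `]c, e'] (fun a => H a `^ p).
  by move=> c0; apply: measurable_fun_poweR; exact: measurable_hausdorff_cut0.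
(* Up to level [h] both cuts are compared with {0} through the uniform tail; above it they are
   compared through the grid. *)
have split01 : `]0%R, 1%R : R]%classic = `]0%R, h] `|` `]h, 1%R].
  by rewrite (@itv_bndbnd_setU _ _ _ (BRight h))// bnd_simp ?(ltW hgt0).
have -> : \int[mu]_(a in `]0%R, 1%R]) (H a `^ p) =
    \int[mu]_(a in `]0%R, h]) (H a `^ p) + \int[mu]_(a in `]h, 1%R]) (H a `^ p).
  rewrite split01; apply: ge0_integral_setU => //.
  - by rewrite -split01; exact: mH.
  - by move=> a _; exact: poweR_ge0.
  - apply/disj_setPLR => a /=; rewrite !in_itv/= => /andP[_ ah].
    by rewrite ltNge ah.
apply: (@le_lt_trans _ _
    (K%:E * (t%:E + t%:E + 0) + K%:E * (t%:E + t%:E + t%:E))); last first.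
  rewrite adde0 -!EFinD lte_fin.
  have -> : (K * (t + t) + K * (t + t + t) = 5 / 6 * eps `^ p)%R.
    by rewrite /t; field; rewrite gt_eqF.
  lra.
apply: leeD.
- apply: (le_trans (@integral_poweR_le3 _ p _ _
    (fun a => hausdorff_dist (cut u a) [set 0%R])
    (fun a => hausdorff_dist (cut v a) [set 0%R]) (cst 0)
    (ltW p0) (measurable_itv _) _ _ _ _ _ _)).
  + exact: measurable_hausdorff_cut0.
  + exact: measurable_hausdorff_set0.
  + exact: measurable_hausdorff_set0.
  + exact: measurable_cst.
  + move=> a /=; rewrite in_itv/= => /andP[a0 ah].
    have a01 : (0 <= a <= 1)%R by apply/andP; split; lra.
    by split=> //; exact: hausdorff_cut_ge0.
  + move=> a /=; rewrite in_itv/= => /andP[a0 ah].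
    have a01 : (0 <= a <= 1)%R by apply/andP; split; lra.
    rewrite adde0 [X in _ + X]hausdorff_distC.
    apply: hausdorff_dist_triangle; first exact: cut_neq0.
    by exists 0%R.
  rewrite lee_wpmul2l ?lee_fin ?powR_ge0//; apply: leeD; first apply: leeD.
  + by apply: hP => //; rewrite hgt0.
  + by apply: hP => //; rewrite hgt0.
  + by rewrite /= integral_cst_itv ?(ltW hgt0)// powR0 ?gt_eqF// mul0e.
- apply: (le_trans (@integral_poweR_le3 _ p _ _
    (fun a => hausdorff_dist (cut u a) (cut u (a - h)%R)) (cst e%:E)
    (fun a => hausdorff_dist (cut v a) (cut v (a - h)%R))
    (ltW p0) (measurable_itv _) _ _ _ _ _ _)).
  + by apply: measurable_hausdorff_cut0 => //; exact: ltW.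
  + by apply: measurable_hausdorff_cutB => //; exact: ltW.
  + exact: measurable_cst.
  + by apply: measurable_hausdorff_cutB => //; exact: ltW.
  + move=> a /=; rewrite in_itv/= => /andP[ha a1].
    have a01 : (0 <= a <= 1)%R by apply/andP; split; lra.
    by split; rewrite ?lee_fin ?(ltW e0)//; exact: hausdorff_cut_ge0.
  + move=> a /=; rewrite in_itv/= => /andP[ha a1].
    have ah0 : (0 <= a / h)%R by rewrite divr_ge0 ?(ltW hgt0)//; lra.
    (* Here k h <= a < (k + 1) h, so k h lies between a - h and a; and a > h forces k >= 1, which
       puts the level k h in the range covered by [rho]. *)
    pose k := Num.truncn (a / h).
    have /andP[] := truncn_itv ah0; rewrite -/k ler_pdivlMr// ltr_pdivrMr// => ka.
    rewrite -natr1 mulrDl mul1r => ak.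
    have k1 : (h <= k%:R * h)%R.
      rewrite ler_peMl ?(ltW hgt0)// (ler_nat _ 1) /k truncn_gt_nat.
      by rewrite ler_pdivlMr// mul1r ltW.
    apply: (@hausdorff_cut_le_grid e h (k%:R * h)%R) => //.
    * by rewrite subr_ge0 ltW.
    * by lra.
    * by rewrite ka.
    apply: codeP => //.
    * by rewrite ltnS le_truncn// ler_piMl// invr_ge0 ltW.
    * by move=> x; exact: rhoP.
    * by move=> x; exact: rhoP.
  rewrite lee_wpmul2l ?lee_fin ?powR_ge0//; apply: leeD; first apply: leeD.
  + by apply: dP => //; rewrite (ltW hgt0).
  + rewrite /= integral_cst_itv// (powRVK p0 t0) -EFinM lee_fin.
    by rewrite ler_piMr ?(ltW t0)//; lra.
  + by apply: dP => //; rewrite (ltW hgt0).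
Qed.

End sufficiency.

Theorem theorem6p14 (R : realType) (m : nat) (hm : (1 <= m)%N)
    (p : R) (hp : 1 <= p) (X : set ('rV[R]_m -> R))
    (hX : [\/ X = @fuzzy_Stilde R m, X = @fuzzy_E R m,
              X = @fuzzy_S0 R m | X = @fuzzy_S R m])
    (U : set ('rV[R]_m -> R)) (hU : U `<=` X) :
  totally_bounded_in (dp p) X U <->
  p_mean_bounded p U /\ p_mean_equi_left_continuous p U.
Proof.
have p0 : 0 < p by exact: lt_le_trans hp.
have XFB : X `<=` @FB R m by case: hX => -> u [].
split=> [tbU|[]]; last exact: totally_bounded_of_mean.
split; first exact: totally_bounded_p_mean_bounded tbU.
exact: totally_bounded_equi_left_continuous tbU.
Qed.
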